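(* Let $G$ be a group. The category of $\mathbb{G}_m$-central extensions of $G$ is equivalent to the category of $\mathbb{G}_m$-gerbes over the classifying stack $\mathbb{B}G$.
   Context: A $\mathbb{G}_m$-central extension of $G$ is a group $\widetilde G$ that is an extension of $G$ by $\mathbb{G}_m$ in which $\mathbb{G}_m$ is central. A $\mathbb{G}_m$-gerbe over a point is a groupoid $C$ which is connected (there is an arrow between any two objects) and such that $\mathrm{Aut}(X)\simeq\mathbb{G}_m$ for any object $X$ of $C$. By descent, a $\mathbb{G}_m$-gerbe over $\mathbb{B}G$ is the same as a $\mathbb{G}_m$-gerbe $C$ over a point with an action of $G$. An action of $G$ on a category $C$ consists of a functor $F_g:C\to C$ for each $g\in G$ and natural transformations $\tau_{g,h}:F_{gh}\to F_gF_h$ such that $F_{g_1}(\tau_{g_2,g_3})\circ\tau_{g_1,g_2g_3}=(\tau_{g_1,g_2}F_{g_3})\circ\tau_{g_1g_2,g_3}$ for all $g_1,g_2,g_3\in G$, with $F_1=\mathrm{Id}$, $\tau_{1,g}=\mathrm{Id}$ and $\tau_{g,1}=\mathrm{Id}$. Again by descent, along the cover $pt\to\mathbb{B}G$, a $\mathbb{G}_m$-gerbe over $\mathbb{B}G$ gives a line bundle $L$ over $G$ with an isomorphism $p_1^*(L)\otimes p_2^*(L)\to m^*(L)$ over $G\times G$ (where $p_1,p_2$ are the projections and $m$ is the multiplication), which gives a product covering that of $G$, together with a coherence relation saying that this product is associative. *)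

(* Defs.v *)
From HB Require Import structures.
From mathcomp Require Import all_boot all_algebra.

Set Implicit Arguments.
Unset Strict Implicit.
Unset Printing Implicit Defensive.

Import GRing.Theory.
Local Open Scope group_scope.

(* [{unit F}] carries a group structure only for finite rings, hence the
   following construction of the multiplicative group of a field. *)
Record Gm (F : fieldType) := MkGm { Gm_val :> F; _ : Gm_val != 0%R }.

HB.instance Definition _ (F : fieldType) := [isSub for @Gm_val F].
HB.instance Definition _ (F : fieldType) := [Choice of Gm F by <:].

Section GmGroup.
Variable F : fieldType.
Implicit Types a b c : Gm F.

Fact Gm_neq0 a : (a : F) != 0%R. Proof. exact: (valP a). Qed.

Definition Gm_one : Gm F := MkGm (oner_neq0 F).
Definition Gm_mul a b : Gm F := MkGm (mulf_neq0 (Gm_neq0 a) (Gm_neq0 b)).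
Definition Gm_inv a : Gm F := MkGm (invr_neq0 (Gm_neq0 a)).

Fact Gm_mulA : associative Gm_mul.
Proof. by move=> a b c; apply/val_inj/mulrA. Qed.
Fact Gm_mul1 : left_id Gm_one Gm_mul.
Proof. by move=> a; apply/val_inj/mul1r. Qed.
Fact Gm_mulr1 : right_id Gm_one Gm_mul.
Proof. by move=> a; apply/val_inj/mulr1. Qed.
Fact Gm_mulV : left_inverse Gm_one Gm_inv Gm_mul.
Proof. by move=> a; apply/val_inj/mulVf/Gm_neq0. Qed.
Fact Gm_mulrV : right_inverse Gm_one Gm_inv Gm_mul.
Proof. by move=> a; apply/val_inj/mulfV/Gm_neq0. Qed.

HB.instance Definition _ :=
  isGroup.Build (Gm F) Gm_mulA Gm_mul1 Gm_mulr1 Gm_mulV Gm_mulrV.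
End GmGroup.

(* Each hom-type carries an equivalence [ceq], read as equality of morphisms:
   the hom-sets are the quotients of the types [chom X Y] by [ceq]. *)
Record category := Category {
  cob :> Type;
  chom : cob -> cob -> Type;
  ceq : forall X Y, chom X Y -> chom X Y -> Prop;
  cidm : forall X, chom X X;
  ccomp : forall X Y Z, chom Y Z -> chom X Y -> chom X Z;
  ceq_refl : forall X Y (f : chom X Y), ceq f f;
  ceq_sym : forall X Y (f g : chom X Y), ceq f g -> ceq g f;
  ceq_trans : forall X Y (f g h : chom X Y), ceq f g -> ceq g h -> ceq f h;
  ccomp_ceq : forall X Y Z (g g' : chom Y Z) (f f' : chom X Y),
    ceq g g' -> ceq f f' -> ceq (ccomp g f) (ccomp g' f');
  ccomp1f : forall X Y (f : chom X Y), ceq (ccomp (cidm Y) f) f;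
  ccompf1 : forall X Y (f : chom X Y), ceq (ccomp f (cidm X)) f;
  ccompA : forall X Y Z W (h : chom Z W) (g : chom Y Z) (f : chom X Y),
    ceq (ccomp h (ccomp g f)) (ccomp (ccomp h g) f) }.

Arguments cidm {_} X.

Record functor (A B : category) := Functor {
  fob :> A -> B;
  fmap : forall X Y, chom X Y -> chom (fob X) (fob Y);
  fmap_ceq : forall X Y (f g : chom X Y), ceq f g -> ceq (fmap f) (fmap g);
  fmap1 : forall X, ceq (fmap (cidm X)) (cidm (fob X));
  fmapM : forall X Y Z (g : chom Y Z) (f : chom X Y),
    ceq (fmap (ccomp g f)) (ccomp (fmap g) (fmap f)) }.

Definition functor_id (A : category) : functor A A :=
  @Functor A A id (fun X Y f => f) (fun X Y f g e => e)
    (fun X => ceq_refl _) (fun X Y Z g f => ceq_refl _).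

Lemma functor_comp_subproof1 (A B C : category) (T : functor B C)
  (S : functor A B) X : ceq (fmap T (fmap S (cidm X))) (cidm (T (S X))).
Proof. exact: ceq_trans (fmap_ceq T (fmap1 S X)) (fmap1 T (S X)). Qed.

Lemma functor_comp_subproofM (A B C : category) (T : functor B C)
    (S : functor A B) X Y Z (g : chom Y Z) (f : chom X Y) :
  ceq (fmap T (fmap S (ccomp g f)))
      (ccomp (fmap T (fmap S g)) (fmap T (fmap S f))).
Proof. exact: ceq_trans (fmap_ceq T (fmapM S g f)) (fmapM T _ _). Qed.

Definition functor_comp (A B C : category) (T : functor B C) (S : functor A B) :
    functor A C :=
  @Functor A C (fun X => T (S X)) (fun X Y f => fmap T (fmap S f))
    (fun X Y f g e => fmap_ceq T (fmap_ceq S e))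
    (functor_comp_subproof1 T S) (functor_comp_subproofM T S).

Definition naturally_isomorphic (A B : category) (S T : functor A B) : Prop :=
  exists (eta : forall X, chom (S X) (T X)) (eta' : forall X, chom (T X) (S X)),
    [/\ forall X Y (f : chom X Y),
          ceq (ccomp (fmap T f) (eta X)) (ccomp (eta Y) (fmap S f)),
        forall X, ceq (ccomp (eta' X) (eta X)) (cidm (S X))
      & forall X, ceq (ccomp (eta X) (eta' X)) (cidm (T X))].

Definition equivalent_categories (A B : category) : Prop :=
  exists (S : functor A B) (T : functor B A),
    naturally_isomorphic (functor_comp T S) (functor_id A) /\
    naturally_isomorphic (functor_comp S T) (functor_id B).

Section CentralExtensions.
Variables (F : fieldType) (G : groupType).

Record central_extension := CentralExtension {
  ext_group :> groupType;
  ext_in : {multiplicative Gm F -> ext_group};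
  ext_pr : {multiplicative ext_group -> G};
  ext_in_inj : injective ext_in;
  ext_pr_surj : forall g, exists x, ext_pr x = g;
  ext_exact : forall x, ext_pr x = 1 <-> exists a, x = ext_in a;
  ext_central : forall a x, commute (ext_in a) x }.

Record extension_morphism (E E' : central_extension) := ExtensionMorphism {
  em_fun :> {multiplicative E -> E'};
  em_in : forall a, em_fun (ext_in E a) = ext_in E' a;
  em_pr : forall x, ext_pr E' (em_fun x) = ext_pr E x }.

Definition em_id (E : central_extension) : extension_morphism E E :=
  @ExtensionMorphism E E (@idfun E) (fun a => erefl) (fun x => erefl).

Program Definition em_comp (E1 E2 E3 : central_extension)
    (g : extension_morphism E2 E3) (f : extension_morphism E1 E2) :
    extension_morphism E1 E3 :=
  @ExtensionMorphism E1 E3 (g \o f) _ _.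
Next Obligation. by move=> * /=; rewrite !em_in. Qed.
Next Obligation. by move=> * /=; rewrite !em_pr. Qed.

Program Definition central_extensions : category :=
  @Category central_extension extension_morphism
    (fun E E' f g => f =1 g) em_id em_comp _ _ _ _ _ _ _.
Next Obligation. by []. Qed.
Next Obligation. by move=> E E' f g e x; rewrite e. Qed.
Next Obligation. by move=> E E' f g h e e' x; rewrite e e'. Qed.
Next Obligation. by move=> E1 E2 E3 g g' f f' e e' x /=; rewrite e' e. Qed.
Next Obligation. by []. Qed.
Next Obligation. by []. Qed.
Next Obligation. by []. Qed.
End CentralExtensions.

Declare Scope gpd_scope.

Record groupoid := Groupoid {
  gob :> Type;
  arr : gob -> gob -> Type;
  hid : forall X, arr X X;
  hcomp : forall X Y Z, arr Y Z -> arr X Y -> arr X Z;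
  hinv : forall X Y, arr X Y -> arr Y X;
  hcomp1f : forall X Y (f : arr X Y), hcomp (hid Y) f = f;
  hcompf1 : forall X Y (f : arr X Y), hcomp f (hid X) = f;
  hcompA : forall X Y Z W (h : arr Z W) (g : arr Y Z) (f : arr X Y),
    hcomp h (hcomp g f) = hcomp (hcomp h g) f;
  hinvf : forall X Y (f : arr X Y), hcomp (hinv f) f = hid X;
  hfinv : forall X Y (f : arr X Y), hcomp f (hinv f) = hid Y }.

Arguments hid {_} X.
Notation "g \o f" := (hcomp g f) : gpd_scope.
Local Open Scope gpd_scope.

(* The identity of [X], seen as an arrow to an object equal to [X]. *)
Definition eq_hom (C : groupoid) (X Y : C) (e : X = Y) : arr X Y :=
  match e with erefl => hid X end.

Section Gerbes.
Variable F : fieldType.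

(* [gb_aut X] is the isomorphism of Gm with Aut(X); [gb_aut_nat] says that
   these identifications agree along all arrows, so that Gm acts on C. *)
Record gerbe := Gerbe {
  gb_gpd :> groupoid;
  gb_inhabited : inhabited gb_gpd;
  gb_connected : forall X Y : gb_gpd, inhabited (arr X Y);
  gb_aut : forall X : gb_gpd, Gm F -> arr X X;
  gb_aut_bij : forall X, bijective (gb_aut X);
  gb_autM : forall X a b, gb_aut X (a * b) = gb_aut X a \o gb_aut X b;
  gb_aut_nat : forall (X Y : gb_gpd) (f : arr X Y) a,
    f \o gb_aut X a = gb_aut Y a \o f }.

Arguments gb_aut {_} X a.

(* Functors between Gm-gerbes respect the identifications Aut(X) = Gm; for the
   functors of an action this is what makes the associated extension central. *)
Record gerbe_functor (C D : gerbe) := GerbeFunctor {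
  gf_ob :> C -> D;
  gf_map : forall X Y : C, arr X Y -> arr (gf_ob X) (gf_ob Y);
  gf_map1 : forall X, gf_map (hid X) = hid (gf_ob X);
  gf_mapM : forall (X Y Z : C) (g : arr Y Z) (f : arr X Y),
    gf_map (g \o f) = gf_map g \o gf_map f;
  gf_aut : forall X a, gf_map (gb_aut X a) = gb_aut (gf_ob X) a }.

Arguments gf_map {C D} _ [X Y] f.

Definition gf_id (C : gerbe) : gerbe_functor C C :=
  @GerbeFunctor C C id (fun X Y f => f) (fun X => erefl)
    (fun X Y Z g f => erefl) (fun X a => erefl).

Program Definition gf_comp (C D E : gerbe)
    (Psi : gerbe_functor D E) (Phi : gerbe_functor C D) : gerbe_functor C E :=
  @GerbeFunctor C E (fun X => Psi (Phi X))
    (fun X Y f => gf_map Psi (gf_map Phi f)) _ _ _.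
Next Obligation. by move=> * /=; rewrite !gf_map1. Qed.
Next Obligation. by move=> * /=; rewrite !gf_mapM. Qed.
Next Obligation. by move=> * /=; rewrite !gf_aut. Qed.

Definition eq_gf_ob (C D : gerbe) (Phi Psi : gerbe_functor C D)
    (e : Phi = Psi) (X : C) : Phi X = Psi X :=
  congr1 (fun Theta : gerbe_functor C D => Theta X) e.

Section Actions.
Variable G : groupType.

(* The functors F_(g1 (g2 g3)) and F_((g1 g2) g3), F_(1 g) and F_1 F_g, and
   F_(g 1) and F_g F_1 are equal but not convertible: [eq_hom] mediates
   between them, and the last two fields say that tau_(1,g) and tau_(g,1) are
   identities. *)
Record gerbe_action (C : gerbe) := Action {
  act :> G -> gerbe_functor C C;
  act_tau : forall g h X, arr (act (g * h) X) (act g (act h X));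
  act_tau_nat : forall g h (X Y : C) (f : arr X Y),
    gf_map (act g) (gf_map (act h) f) \o act_tau g h X
    = act_tau g h Y \o gf_map (act (g * h)) f;
  act_tauA : forall g1 g2 g3 X,
    gf_map (act g1) (act_tau g2 g3 X) \o act_tau g1 (g2 * g3) X
    = act_tau g1 g2 (act g3 X) \o act_tau (g1 * g2) g3 X
      \o eq_hom (eq_gf_ob (congr1 act (mulgA g1 g2 g3)) X);
  act1 : act 1 = gf_id C;
  act_tau1g : forall g X,
    act_tau 1 g X
    = eq_hom (etrans (eq_gf_ob (congr1 act (mul1g g)) X)
                     (esym (eq_gf_ob act1 (act g X))));
  act_taug1 : forall g X,
    act_tau g 1 X
    = eq_hom (etrans (eq_gf_ob (congr1 act (mulg1 g)) X)
                     (esym (congr1 (act g) (eq_gf_ob act1 X)))) }.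

(* A gerbe over BG, presented by descent along pt -> BG: its pullback to the
   point together with the action of G on it. *)
Record gerbeBG := GerbeBG {
  gBG_fiber :> gerbe;
  gBG_act : gerbe_action gBG_fiber }.

Arguments act_tau {C} _ g h X.

(* The identity beta_1 = Id follows from [gm_tau] with g = h = 1. *)
Record gerbeBG_morphism (A B : gerbeBG) := GerbeBGMorphism {
  gm_fun :> gerbe_functor A B;
  gm_beta : forall g X, arr (gm_fun (gBG_act A g X)) (gBG_act B g (gm_fun X));
  gm_beta_nat : forall g (X Y : A) (f : arr X Y),
    gf_map (gBG_act B g) (gf_map gm_fun f) \o gm_beta g X
    = gm_beta g Y \o gf_map gm_fun (gf_map (gBG_act A g) f);
  gm_tau : forall g h X,
    act_tau (gBG_act B) g h (gm_fun X) \o gm_beta (g * h) X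
    = gf_map (gBG_act B g) (gm_beta h X) \o gm_beta g (gBG_act A h X)
      \o gf_map gm_fun (act_tau (gBG_act A) g h X) }.

Arguments gm_beta {A B} _ g X.

(* Existence of a 2-morphism; it is invertible, its components being arrows
   of a groupoid. *)
Definition isomorphic_morphisms (A B : gerbeBG)
    (Phi Psi : gerbeBG_morphism A B) : Prop :=
  exists theta : forall X : A, arr (Phi X) (Psi X),
    (forall (X Y : A) (f : arr X Y),
       gf_map Psi f \o theta X = theta Y \o gf_map Phi f) /\
    (forall g X, gf_map (gBG_act B g) (theta X) \o gm_beta Phi g X
       = gm_beta Psi g X \o theta (gBG_act A g X)).

Program Definition gm_id (A : gerbeBG) : gerbeBG_morphism A A :=
  @GerbeBGMorphism A A (gf_id A) (fun g X => hid (gBG_act A g X)) _ _.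
Next Obligation. by move=> * /=; rewrite hcompf1 hcomp1f. Qed.
Next Obligation. by move=> * /=; rewrite gf_map1 hcompf1 !hcomp1f. Qed.

Program Definition gm_comp (A B C : gerbeBG)
    (Psi : gerbeBG_morphism B C) (Phi : gerbeBG_morphism A B) :
    gerbeBG_morphism A C :=
  @GerbeBGMorphism A C (gf_comp Psi Phi)
    (fun g X => gm_beta Psi g (Phi X) \o gf_map Psi (gm_beta Phi g X)) _ _.
Next Obligation.
move=> A B C Psi Phi g X Y f /=.
by rewrite hcompA gm_beta_nat -!hcompA -!gf_mapM gm_beta_nat.
Qed.
Next Obligation.
move=> A B C Psi Phi g h X /=.
rewrite hcompA gm_tau -!hcompA -gf_mapM gm_tau !gf_mapM !hcompA.
by congr (_ \o _ \o _); rewrite -!hcompA; congr (_ \o _); rewrite gm_beta_nat.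
Qed.

(* Gerbes over BG form a 2-category; the category considered here has as
   morphisms the 1-morphisms up to 2-isomorphism. *)
Program Definition gerbesBG : category :=
  @Category gerbeBG gerbeBG_morphism isomorphic_morphisms gm_id gm_comp
    _ _ _ _ _ _ _.
Next Obligation.
by move=> A B Phi; exists (fun X => hid _);
  split=> * /=; rewrite ?gf_map1 hcompf1 hcomp1f.
Qed.
Next Obligation.
move=> A B Phi Psi [theta [nat_th act_th]].
exists (fun X => hinv (theta X)); split=> [X Y f|g X].
  rewrite -[LHS]hcomp1f -(hinvf (theta Y)) -hcompA (hcompA (theta Y)) -nat_th.
  by rewrite -hcompA hfinv hcompf1.
rewrite -[RHS]hcomp1f -(gf_map1 (gBG_act B g)) -(hinvf (theta X)) gf_mapM.
rewrite -!hcompA; congr (_ \o _).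
by rewrite hcompA act_th -hcompA hfinv hcompf1.
Qed.
Next Obligation.
move=> A B Phi Psi Xi [th [n_th a_th]] [th' [n_th' a_th']].
exists (fun X => th' X \o th X); split=> [X Y f|g X].
  by rewrite hcompA n_th' -!hcompA n_th.
by rewrite gf_mapM -hcompA a_th !hcompA a_th'.
Qed.
Next Obligation.
move=> A B C Psi Psi' Phi Phi' [th' [n_th' a_th']] [th [n_th a_th]].
exists (fun X => th' (Phi' X) \o gf_map Psi (th X)); split=> [X Y f|g X] /=.
  by rewrite hcompA n_th' -!hcompA -!gf_mapM n_th.
rewrite gf_mapM -!hcompA (hcompA (gf_map _ (gf_map _ _))) gm_beta_nat.
rewrite -!hcompA -gf_mapM a_th gf_mapM !hcompA a_th' -!hcompA.
by congr (_ \o _); rewrite !hcompA n_th'.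
Qed.
Next Obligation.
move=> A B Phi; exists (fun X => hid _).
by split=> *; rewrite ?gf_map1 /= !hcompf1 !hcomp1f.
Qed.
Next Obligation.
move=> A B Phi; exists (fun X => hid _).
by split=> *; rewrite ?gf_map1 /= ?gf_map1 !hcompf1 ?hcomp1f.
Qed.
Next Obligation.
move=> A B C D Xi Psi Phi; exists (fun X => hid _).
by split=> *; rewrite ?gf_map1 /= ?gf_mapM !hcompf1 !hcomp1f ?hcompA.
Qed.
End Actions.
End Gerbes.

(* Main.v *)
Require Import Defs.
From mathcomp Require Import all_boot all_algebra.
From HB Require Import structures.
From mathcomp Require Import boolp.
From Stdlib Require Import Setoid Morphisms.

(* A set-theoretic section of an extension E -> G turns E into a 2-cocycle
   c : G x G -> Gm, and G acts on the one-object gerbe with automorphism group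
   Gm by the identity functors, with tau = c^-1.  In terms of sections, a
   morphism of extensions is a function b : G -> Gm relating the two cocycles,
   which is exactly a morphism of the associated gerbes; a 2-isomorphism between
   two of these is a constant in Gm, and so does not change b.  Hence
   E |-> (gerbe of E) is fully faithful.  It is essentially surjective: for an
   object X of a gerbe with G-action, arrows t_g : X -> F_g X yield a cocycle,
   hence an extension whose gerbe maps to the given one, and every morphism of
   Gm-gerbes over BG is invertible. *)

Set Implicit Arguments.
Unset Strict Implicit.
Unset Printing Implicit Defensive.

Import GRing.Theory.
Local Open Scope group_scope.
#[local] Obligation Tactic := idtac.

(** * Fully faithful, essentially surjective functors *)

#[global] Instance ceq_equivalence (A : category) (X Y : A) :
  Equivalence (@ceq A X Y).
Proof. split=> ?; [exact: ceq_refl | exact: ceq_sym | exact: ceq_trans]. Qed.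

#[global] Instance ccomp_proper (A : category) (X Y Z : A) :
  Proper (@ceq A Y Z ==> @ceq A X Y ==> @ceq A X Z) (@ccomp A X Y Z).
Proof. by move=> g g' eg f f' ef; apply: ccomp_ceq. Qed.

#[global] Instance fmap_proper (A B : category) (S : functor A B) (X Y : A) :
  Proper (@ceq A X Y ==> @ceq B (S X) (S Y)) (@fmap A B S X Y).
Proof. by move=> f f' ef; apply: fmap_ceq. Qed.

#[local] Hint Resolve ceq_refl : core.

Section FullyFaithful.
Variables (A B : category) (S : functor A B).
Hypothesis faithful : forall X Y (f f' : chom X Y),
  ceq (fmap S f) (fmap S f') -> ceq f f'.
Hypothesis full : forall X Y (g : chom (S X) (S Y)),
  exists f, ceq (fmap S f) g.
Hypothesis ess_surj : forall Y, exists X (i : chom (S X) Y) (j : chom Y (S X)),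
  ceq (ccomp i j) (cidm Y) /\ ceq (ccomp j i) (cidm (S X)).

(** The quasi-inverse sends [Y] to a chosen preimage [T0 Y], with isomorphisms [i Y] and [j Y], and
    an arrow to the lift of its conjugate by these. *)
Lemma fully_faithful_equivalence : equivalent_categories A B.
Proof.
have /choice[T0 T0P] := ess_surj.
pose i Y := sval (cid (T0P Y)); pose j Y := sval (cid (svalP (cid (T0P Y)))).
have ij Y : ceq (ccomp (i Y) (j Y)) (cidm Y).
  by have [] := svalP (cid (svalP (cid (T0P Y)))).
have ji Y : ceq (ccomp (j Y) (i Y)) (cidm (S (T0 Y))).
  by have [] := svalP (cid (svalP (cid (T0P Y)))).
pose lift X Y (g : chom (S X) (S Y)) := sval (cid (full g)).
have liftP X Y (g : chom (S X) (S Y)) : ceq (fmap S (lift _ _ g)) g.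
  exact: svalP (cid (full g)).
pose T1 Y Z (g : chom Y Z) := lift _ _ (ccomp (j Z) (ccomp g (i Y))).
have T1P Y Z (g : chom Y Z) : ceq (ccomp (i Z) (fmap S (T1 _ _ g)))
                                  (ccomp g (i Y)).
  by rewrite /T1 liftP ccompA ij ccomp1f.
(* The laws of [T] are checked after applying [S] and composing with the invertible [i Y]. *)
have iI X Y (f f' : chom X (T0 Y)) :
  ceq (ccomp (i Y) (fmap S f)) (ccomp (i Y) (fmap S f')) -> ceq f f'.
  move=> e; apply: faithful.
  by rewrite -[fmap S f]ccomp1f -[fmap S f']ccomp1f -(ji Y) -!ccompA e.
have T1_ceq Y Z (g g' : chom Y Z) : ceq g g' -> ceq (T1 _ _ g) (T1 _ _ g').
  by move=> e; apply: iI; rewrite !T1P e.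
have T1_1 Y : ceq (T1 _ _ (cidm Y)) (cidm (T0 Y)).
  by apply: iI; rewrite T1P fmap1 ccomp1f ccompf1.
have T1_M X Y Z (g : chom Y Z) (f : chom X Y) :
  ceq (T1 _ _ (ccomp g f)) (ccomp (T1 _ _ g) (T1 _ _ f)).
  by apply: iI; rewrite T1P fmapM ccompA T1P -!ccompA T1P.
pose T := Functor T1_ceq T1_1 T1_M.
exists S, T; split; last first.
  exists i, j; split=> [Y Z g|Y|Y]; last exact: ij.
    exact: ceq_sym (T1P _ _ _).
  exact: ji.
exists (fun X => lift (T0 (S X)) X (i (S X))),
       (fun X => lift X (T0 (S X)) (j (S X))).
split=> [X Y f|X|X]; apply: faithful.
- apply: ceq_trans (fmapM _ _ _) (ceq_trans _ (ceq_sym (fmapM _ _ _))).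
  rewrite (liftP _ _ (i (S X))) (liftP _ _ (i (S Y))).
  exact: ceq_sym (T1P _ _ _).
- by rewrite fmapM !liftP fmap1 ji.
- by rewrite fmapM !liftP fmap1 ij.
Qed.
End FullyFaithful.

(** * Arrows of groupoids and of gerbes *)

Lemma Gm_mulC (F : fieldType) (a b : Gm F) : a * b = b * a.
Proof. by apply/val_inj/mulrC. Qed.

Section Groupoids.
Local Open Scope gpd_scope.
Variable C : groupoid.
Implicit Types X Y Z : C.

Lemma hcompKf X Y Z (g : arr Y Z) (f : arr X Y) : hinv g \o (g \o f) = f.
Proof. by rewrite hcompA hinvf hcomp1f. Qed.

Lemma hcompVKf X Y Z (g : arr Z Y) (f : arr X Y) : g \o (hinv g \o f) = f.
Proof. by rewrite hcompA hfinv hcomp1f. Qed.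

Lemma hcompI X Y Z (g : arr Y Z) (f f' : arr X Y) : g \o f = g \o f' -> f = f'.
Proof. by move=> e; rewrite -(hcompKf g f) e hcompKf. Qed.

End Groupoids.

Section GerbeTheory.
Local Open Scope gpd_scope.
Variable F : fieldType.
Implicit Types C D : gerbe F.

Lemma gb_aut_inj C (X : C) : injective (@gb_aut F C X).
Proof. exact: bij_inj (gb_aut_bij X). Qed.

Lemma gb_aut_surj C (X : C) (f : arr X X) : exists a, gb_aut X a = f.
Proof. by have [h _ hK] := gb_aut_bij X; exists (h f). Qed.

Lemma gb_aut1 C (X : C) : gb_aut X 1 = hid X.
Proof.
by apply: (hcompI (g := gb_aut X 1)); rewrite -gb_autM mulg1 hcompf1.
Qed.

Variables (C D : gerbe F) (Phi : gerbe_functor C D).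

(** Parallel arrows differ by an element of [Gm], and [Phi] respects [Gm]. Injectivity holds for the
    same reason. *)
Lemma gf_map_surj (X Y : C) (g : arr (Phi X) (Phi Y)) :
  exists f, gf_map Phi f = g.
Proof.
have [f0] := gb_connected X Y.
have [a ea] := gb_aut_surj (hinv (gf_map Phi f0) \o g).
by exists (f0 \o gb_aut X a); rewrite gf_mapM gf_aut ea hcompVKf.
Qed.

Lemma gf_map_inj (X Y : C) : injective (@gf_map F C D Phi X Y).
Proof.
move=> f f' e; have [a ea] := gb_aut_surj (hinv f \o f').
have ef : f' = f \o gb_aut X a by rewrite ea hcompVKf.
suff a1 : a = 1 by rewrite ef a1 gb_aut1 hcompf1.
apply: (@gb_aut_inj _ (Phi X)); apply: (hcompI (g := gf_map Phi f)).
by rewrite -gf_aut -gf_mapM -ef -e gb_aut1 hcompf1.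
Qed.

End GerbeTheory.

(** * Invertibility of morphisms of gerbes over BG *)

Section GerbesBG.
Local Open Scope gpd_scope.
Variables (F : fieldType) (G : groupType).

(* A morphism of gerbes is bijective on arrows and every object of the target
   is isomorphic to one in the image; choosing such isomorphisms [q Y] gives a
   quasi-inverse. *)
Lemma gerbeBG_morphism_inv (A B : gerbesBG F G) (Phi : chom A B) :
  exists Psi : chom B A,
    ceq (ccomp Phi Psi) (cidm B) /\ ceq (ccomp Psi Phi) (cidm A).
Proof.
move: A B Phi => /= A B Phi; have [X0] := gb_inhabited A.
pose lift X Y (g : arr (Phi X) (Phi Y)) := sval (cid (gf_map_surj g)).
have liftK X Y (g : arr (Phi X) (Phi Y)) : gf_map Phi (lift _ _ g) = g.
  exact: svalP (cid (gf_map_surj g)).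
have mapI X Y (f f' : arr X Y) : gf_map Phi f = gf_map Phi f' -> f = f'.
  exact: gf_map_inj.
have qX Y : exists q : arr (Phi X0) Y, True.
  by have [q] := gb_connected (Phi X0) Y; exists q.
pose q Y := sval (cid (qX Y)).
pose P1 Y Z (f : arr Y Z) := lift X0 X0 (hinv (q Z) \o (f \o q Y)).
have P1E Y Z (f : arr Y Z) : q Z \o gf_map Phi (P1 _ _ f) = f \o q Y.
  by rewrite liftK hcompVKf.
have qI X Y (f f' : arr X X0) :
  q Y \o gf_map Phi f = q Y \o gf_map Phi f' -> f = f'.
  by move=> e; apply/mapI/hcompI/e.
have P1_1 Y : P1 _ _ (hid Y) = hid X0.
  by apply: (qI _ Y); rewrite P1E gf_map1 hcompf1 hcomp1f.
have P1_M X Y Z (g : arr Y Z) (f : arr X Y) :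
  P1 _ _ (g \o f) = P1 _ _ g \o P1 _ _ f.
  by apply: (qI _ Z); rewrite P1E gf_mapM !hcompA P1E -!hcompA P1E.
have P1_aut Y a : P1 _ _ (gb_aut Y a) = gb_aut X0 a.
  by apply: (qI _ Y); rewrite P1E gf_aut gb_aut_nat.
(* By connectedness of [B], one object [X0] suffices: [P] is constant on objects. *)
pose P := @GerbeFunctor F B A (fun=> X0) P1 P1_1 P1_M P1_aut.
(* The choice is forced by [bE], the compatibility with the actions that makes [q] a 2-morphism to
   the identity. *)
pose b g Y : arr X0 (gBG_act A g X0) := lift X0 (gBG_act A g X0)
  (hinv (gm_beta Phi g X0) \o
     (hinv (gf_map (gBG_act B g) (q Y)) \o q (gBG_act B g Y))).
have bE g Y : gf_map (gBG_act B g) (q Y) \o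
    (gm_beta Phi g X0 \o gf_map Phi (b g Y)) = q (gBG_act B g Y).
  by rewrite /b liftK !hcompVKf.
have b_nat g X Y (f : arr X Y) :
  gf_map (gBG_act A g) (gf_map P f) \o b g X
  = b g Y \o gf_map P (gf_map (gBG_act B g) f).
  apply: mapI; apply: (hcompI (g := gm_beta Phi g X0)).
  apply: (hcompI (g := gf_map (gBG_act B g) (q Y))).
  rewrite !gf_mapM !hcompA -(hcompA _ _ (gf_map Phi (b g Y))) bE P1E.
  rewrite -(hcompA _ _ (gf_map Phi (gf_map _ _))) -gm_beta_nat hcompA.
  by rewrite -gf_mapM P1E gf_mapM -!hcompA bE.
have b_tau g h Y : act_tau (gBG_act A) g h (P Y) \o b (g * h) Y
  = gf_map (gBG_act A g) (b h Y) \o b g (gBG_act B h Y)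
      \o gf_map P (act_tau (gBG_act B) g h Y).
  apply: mapI; apply: (hcompI (g := gm_beta Phi g (gBG_act A h X0))).
  apply: (hcompI (g := gf_map (gBG_act B g) (gm_beta Phi h X0))).
  apply: (hcompI (g := gf_map (gBG_act B g) (gf_map (gBG_act B h) (q Y)))).
  rewrite !gf_mapM.
  (* Pushed to [B], both sides become [q] at [g * h] followed by tau. *)
  transitivity (act_tau (gBG_act B) g h Y \o q (gBG_act B (g * h) Y)).
    rewrite -bE (hcompA (act_tau _ _ _ _)) -act_tau_nat -!hcompA.
    by congr (_ \o _); rewrite !hcompA gm_tau.
  rewrite -P1E -(bE g) -(bE h) !gf_mapM -!hcompA; do 2 congr (_ \o _).
  by rewrite !hcompA gm_beta_nat.
pose Psi := @GerbeBGMorphism F G B A P b b_nat b_tau.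
exists Psi; split.
  exists q; split=> [X Y f|g X] /=; first exact: esym (P1E _ _ _).
  by rewrite bE hcomp1f.
(* The 2-morphism is lifted from [q] along [Phi], and its identities are checked after [Phi]. *)
exists (fun X => lift X0 X (q (Phi X))); split=> [X Y f|g X] /=.
  by apply: mapI; rewrite !gf_mapM !liftK hcompVKf.
apply: mapI; rewrite hcomp1f; apply: (hcompI (g := gm_beta Phi g X)).
rewrite !gf_mapM hcompA -gm_beta_nat.
rewrite (liftK _ _ (q (Phi X))) (liftK _ _ (q (Phi (gBG_act A g X)))).
rewrite -P1E -(bE g).
by rewrite !hcompA.
Qed.

End GerbesBG.

(** * The cocycle of a central extension *)

Section GroupMorphisms.
Variables (H K : groupType) (f : {multiplicative H -> K}).

Lemma group_morph1 : f 1 = 1.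
Proof. by apply: (@mulgI _ (f 1)); rewrite -gmulfM !mulg1. Qed.

Lemma group_morphV x : f x^-1 = (f x)^-1.
Proof.
by apply: (@mulgI _ (f x)); rewrite -gmulfM !mulgV group_morph1.
Qed.
End GroupMorphisms.

(** This is a 2-cocycle for the trivial action of [G]. It may differ from 1 at [(1, 1)], as can
    happen for arrows [t_g] chosen in a gerbe. *)
Definition is_cocycle (F : fieldType) (G : groupType) (c : G -> G -> Gm F) :=
  forall g h k, c h k * c g (h * k) = c g h * c (g * h) k.

Section ExtensionCocycle.
Variables (F : fieldType) (G : groupType).
Implicit Types E : central_extension F G.

(* Normalised at 1, because an action has [F_1 = Id] and [tau_(1,g) = Id]. *)
Definition ext_sec E (g : G) : E :=
  if g == 1 then 1 else sval (cid (ext_pr_surj E g)).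

Lemma ext_sec1 E : ext_sec E 1 = 1.
Proof. by rewrite /ext_sec eqxx. Qed.

Lemma ext_secK E : cancel (ext_sec E) (ext_pr E).
Proof.
move=> g; rewrite /ext_sec; case: eqVneq => [->|_]; first exact: group_morph1.
exact: svalP (cid (ext_pr_surj E g)).
Qed.

Lemma ext_pr_in E a : ext_pr E (ext_in E a) = 1.
Proof. by apply/ext_exact; exists a. Qed.

Lemma ext_decomp E (x : E) : exists a, x = ext_in E a * ext_sec E (ext_pr E x).
Proof.
have [a ea] : exists a, x * (ext_sec E (ext_pr E x))^-1 = ext_in E a.
  by apply/ext_exact; rewrite gmulfM group_morphV ext_secK mulgV.
by exists a; rewrite -ea mulgVK.
Qed.

(** With [ext_pr], this gives coordinates identifying the set [E] with [Gm F * G]. *)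
Definition ext_coef E (x : E) : Gm F := sval (cid (ext_decomp x)).

Lemma ext_coefE E (x : E) : x = ext_in E (ext_coef x) * ext_sec E (ext_pr E x).
Proof. exact: svalP (cid (ext_decomp x)). Qed.

Lemma ext_coef_uniq E (x : E) a g : x = ext_in E a * ext_sec E g ->
  ext_coef x = a.
Proof.
move=> ex; have eg : ext_pr E x = g.
  by rewrite ex gmulfM ext_pr_in ext_secK mul1g.
apply/(@ext_in_inj _ _ E)/(@mulIg _ (ext_sec E g)).
by rewrite -{1}eg -ext_coefE.
Qed.

Definition ext_cocycle E (g h : G) : Gm F :=
  ext_coef (ext_sec E g * ext_sec E h).

Lemma ext_secM E g h :
  ext_sec E g * ext_sec E h = ext_in E (ext_cocycle E g h) * ext_sec E (g * h).
Proof. by rewrite [LHS]ext_coefE gmulfM !ext_secK. Qed.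

Lemma ext_mul E a b g h :
  (ext_in E a * ext_sec E g) * (ext_in E b * ext_sec E h)
  = ext_in E (a * b * ext_cocycle E g h) * ext_sec E (g * h).
Proof.
rewrite -mulgA (mulgA (ext_sec E g)) -(ext_central b) -mulgA ext_secM.
by rewrite !gmulfM !mulgA.
Qed.

Lemma ext_coefM E (x y : E) :
  ext_coef (x * y)
  = ext_coef x * ext_coef y * ext_cocycle E (ext_pr E x) (ext_pr E y).
Proof.
apply: (@ext_coef_uniq _ _ _ (ext_pr E x * ext_pr E y)).
by rewrite -ext_mul -!ext_coefE.
Qed.

Lemma ext_coef_in E a : ext_coef (ext_in E a) = a.
Proof. by apply: (@ext_coef_uniq _ _ _ 1); rewrite ext_sec1 mulg1. Qed.

Lemma ext_coef_sec E g : ext_coef (ext_sec E g) = 1.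
Proof. by apply: (@ext_coef_uniq _ _ _ g); rewrite group_morph1 mul1g. Qed.

(** Compare coefficients in the two bracketings of a product of three section values. *)
Lemma ext_cocycleP E : is_cocycle (ext_cocycle E).
Proof.
move=> g h k.
have := congr1 (@ext_coef E) (mulgA (ext_sec E g) (ext_sec E h) (ext_sec E k)).
by rewrite !ext_coefM !ext_coef_sec !gmulfM !ext_secK !mul1g mulg1.
Qed.

Lemma ext_cocycle1g E g : ext_cocycle E 1 g = 1.
Proof. by rewrite /ext_cocycle ext_sec1 mul1g ext_coef_sec. Qed.

Lemma ext_cocycleg1 E g : ext_cocycle E g 1 = 1.
Proof. by rewrite /ext_cocycle ext_sec1 mulg1 ext_coef_sec. Qed.

(** * Morphisms of extensions as functions from G to Gm *)

Section Morphisms.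
Variables E E' : central_extension F G.

Definition em_coef (f : extension_morphism E E') (g : G) : Gm F :=
  ext_coef (f (ext_sec E g)).

Lemma em_sec (f : extension_morphism E E') g :
  f (ext_sec E g) = ext_in E' (em_coef f g) * ext_sec E' g.
Proof. by rewrite [LHS]ext_coefE em_pr ext_secK. Qed.

Lemma em_coefE (f : extension_morphism E E') x :
  f x = ext_in E' (ext_coef x * em_coef f (ext_pr E x))
          * ext_sec E' (ext_pr E x).
Proof. by rewrite {1}(ext_coefE x) gmulfM em_in em_sec mulgA gmulfM. Qed.

(** Apply [f] to [ext_secM] and compare coefficients: the two cocycles differ by the coboundary of
    [em_coef f]. *)
Lemma em_coefM (f : extension_morphism E E') g h :
  ext_cocycle E g h * em_coef f (g * h)
  = em_coef f g * em_coef f h * ext_cocycle E' g h.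
Proof.
have := congr1 (@ext_coef E') (congr1 f (ext_secM E g h)).
rewrite !gmulfM em_in !ext_coefM ext_coef_in !em_pr ext_pr_in ext_cocycle1g.
by rewrite !ext_secK mulg1 => <-.
Qed.

Variable b : G -> Gm F.
Hypothesis bM : forall g h,
  ext_cocycle E g h * b (g * h) = b g * b h * ext_cocycle E' g h.

(** In coordinates, [(a, g) |-> (a * b g, g)]. *)
Definition em_of_coef_fun (x : E) : E' :=
  ext_in E' (ext_coef x * b (ext_pr E x)) * ext_sec E' (ext_pr E x).

Lemma em_of_coef_funM : {morph em_of_coef_fun : x y / x * y}.
Proof.
move=> x y; rewrite /em_of_coef_fun ext_mul ext_coefM gmulfM.
congr (ext_in _ _ * _); rewrite -(mulgA (_ * _)) bM !mulgA.
by congr (_ * _ * _); rewrite -!mulgA (Gm_mulC (b _)).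
Qed.

HB.instance Definition _ :=
  isMultiplicative.Build E E' em_of_coef_fun em_of_coef_funM.

Lemma em_of_coef_in a : em_of_coef_fun (ext_in E a) = ext_in E' a.
Proof.
(* Both cocycles are normalised, so [bM 1 1] reads [b 1 = b 1 * b 1]. *)
have b1 : b 1 = 1.
  have := bM 1 1; rewrite !ext_cocycle1g mul1g !mulg1 => e.
  by apply: (@mulgI _ (b 1)); rewrite -e mulg1.
by rewrite /em_of_coef_fun ext_coef_in ext_pr_in b1 ext_sec1 !mulg1.
Qed.

Lemma em_of_coef_pr x : ext_pr E' (em_of_coef_fun x) = ext_pr E x.
Proof. by rewrite gmulfM ext_pr_in ext_secK mul1g. Qed.

Definition em_of_coef : extension_morphism E E' :=
  @ExtensionMorphism F G E E' em_of_coef_fun em_of_coef_in em_of_coef_pr.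

Lemma em_coefK : em_coef em_of_coef =1 b.
Proof.
move=> g; apply: (@ext_coef_uniq _ _ _ g).
by rewrite /= /em_of_coef_fun ext_coef_sec ext_secK mul1g.
Qed.

End Morphisms.

Lemma em_coef_id E g : em_coef (em_id E) g = 1.
Proof. exact: ext_coef_sec. Qed.

Lemma em_coef_comp E1 E2 E3 (f' : extension_morphism E2 E3)
    (f : extension_morphism E1 E2) g :
  em_coef (em_comp f' f) g = em_coef f' g * em_coef f g.
Proof.
apply: (@ext_coef_uniq _ _ _ g).
rewrite /= em_sec gmulfM em_in em_sec mulgA -gmulfM.
by rewrite (Gm_mulC (em_coef f g)).
Qed.

Lemma em_coef_inj E E' (f f' : extension_morphism E E') :
  em_coef f =1 em_coef f' -> f =1 f'.
Proof. by move=> e x; rewrite !em_coefE e. Qed.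

End ExtensionCocycle.

(** * The extension defined by a cocycle *)

Section CocycleExtension.
Variables (F : fieldType) (G : groupType) (k : G -> G -> Gm F).
Hypothesis kP : is_cocycle k.

(** The proof is an argument of the type, so that the group structure can be inferred from the type
    alone. *)
Definition twisted_product (_ : is_cocycle k) : Type := (Gm F * G)%type.
Local Notation E := (twisted_product kP).

HB.instance Definition _ := Choice.on E.

(** The factor [k 1 1] corrects for a cocycle that is not normalised. *)
Definition tw_one : E := ((k 1 1)^-1, 1).
Definition tw_mul (x y : E) : E := (x.1 * y.1 * k x.2 y.2, x.2 * y.2).
Definition tw_inv (x : E) : E :=
  ((k 1 1)^-1 * (k x.2^-1 x.2)^-1 * x.1^-1, x.2^-1).

Lemma cocycle1g g : k 1 g = k 1 1.
Proof. by have := kP 1 1 g; rewrite !mul1g => /mulIg. Qed.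

Lemma cocycleg1 g : k g 1 = k 1 1.
Proof. by have := kP g 1 1; rewrite !mulg1 => /mulIg. Qed.

Lemma tw_mulA : associative tw_mul.
Proof.
move=> [a g] [b h] [d l]; congr pair => /=; last exact: mulgA.
rewrite -!mulgA; congr (_ * (_ * _)).
by rewrite kP !mulgA (Gm_mulC d).
Qed.

Lemma tw_mul1 : left_id tw_one tw_mul.
Proof.
move=> [a g]; rewrite /tw_mul /tw_one /= cocycle1g mul1g.
by rewrite (Gm_mulC _ a) mulgVK.
Qed.

Lemma tw_mulr1 : right_id tw_one tw_mul.
Proof. by move=> [a g]; rewrite /tw_mul /tw_one /= cocycleg1 mulg1 mulgVK. Qed.

Lemma tw_mulV : left_inverse tw_one tw_inv tw_mul.
Proof.
by move=> [a g]; rewrite /tw_mul /tw_inv /tw_one /= !mulgVK mulVg.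
Qed.

Lemma tw_mulrV : right_inverse tw_one tw_inv tw_mul.
Proof.
move=> [a g]; rewrite /tw_mul /tw_inv /tw_one /= (Gm_mulC a) mulgVK mulgV.
(* This symmetry is the cocycle relation at [(g, g^-1, g)]. *)
suff -> : k g g^-1 = k g^-1 g by rewrite mulgVK.
have := kP g g^-1 g; rewrite mulVg mulgV cocycle1g cocycleg1.
by move/mulIg.
Qed.

HB.instance Definition _ :=
  isGroup.Build E tw_mulA tw_mul1 tw_mulr1 tw_mulV tw_mulrV.

Definition tw_in (a : Gm F) : E := (a * (k 1 1)^-1, 1).
Definition tw_pr (x : E) : G := x.2.

Lemma tw_inM : {morph tw_in : a b / a * b}.
Proof.
move=> a b; congr pair => /=; last by rewrite mulg1.
by rewrite /= -!mulgA mulVg mulg1 (Gm_mulC _ b).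
Qed.

Lemma tw_prM : {morph tw_pr : x y / x * y}. Proof. by []. Qed.

HB.instance Definition _ := isMultiplicative.Build (Gm F) E tw_in tw_inM.
HB.instance Definition _ := isMultiplicative.Build E G tw_pr tw_prM.

Lemma tw_in_inj : injective tw_in.
Proof. by move=> a b /(congr1 fst) /mulIg. Qed.

Lemma tw_in_mul a (x : E) : tw_in a * x = (a * x.1, x.2).
Proof.
congr pair => /=; last exact: mul1g.
by rewrite cocycle1g (Gm_mulC (a * _)) mulgA mulgVK Gm_mulC.
Qed.

Lemma tw_pr_surj g : exists x, tw_pr x = g.
Proof. by exists (1, g). Qed.

Lemma tw_exact x : tw_pr x = 1 <-> exists a, x = tw_in a.
Proof.
split=> [|[a ->]] //; case: x => a g /= ->.
by exists (a * k 1 1); rewrite /tw_in mulgK.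
Qed.

Lemma tw_central a x : commute (tw_in a) x.
Proof.
rewrite /commute tw_in_mul; congr pair => /=; last by rewrite mulg1.
by rewrite cocycleg1 mulgA mulgVK Gm_mulC.
Qed.

Definition tw_extension : central_extension F G :=
  @CentralExtension F G E tw_in tw_pr tw_in_inj tw_pr_surj tw_exact tw_central.

End CocycleExtension.

(** * The functor from extensions to gerbes over BG *)

Section GerbeOfExtension.
Local Open Scope gpd_scope.
Variables (F : fieldType) (G : groupType).

Definition pt_groupoid : groupoid :=
  @Groupoid unit (fun _ _ => Gm F) (fun=> 1) (fun _ _ _ g f => g * f)
    (fun _ _ f => f^-1) (fun _ _ => @mul1g _) (fun _ _ => @mulg1 _)
    (fun _ _ _ _ => @mulgA _) (fun _ _ => @mulVg _) (fun _ _ => @mulgV _).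

Definition pt_gerbe : gerbe F :=
  @Gerbe F pt_groupoid (inhabits tt) (fun _ _ => inhabits (1 : Gm F))
    (fun=> id) (fun=> Bijective (frefl id) (frefl id)) (fun _ _ _ => erefl)
    (fun _ _ f a => Gm_mulC f a).

Lemma pt_gerbe_map (C : gerbe F) (Phi : gerbe_functor pt_gerbe C)
  (a : Gm F) : gf_map Phi (a : arr (tt : pt_gerbe) tt) = gb_aut (Phi tt) a.
Proof. exact: (@gf_aut F pt_gerbe C Phi tt a). Qed.

(** This turns the coherence laws of an action on [pt_gerbe] into equations in [Gm]. *)
Lemma pt_eq_hom (X Y : pt_gerbe) (e : X = Y) : eq_hom e = 1 :> Gm F.
Proof. by case: Y / e. Qed.

(** With the inverse cocycle as tau, [gm_tau] for [gm_beta] equal to [em_coef f] is exactly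
    [em_coefM]. *)
Program Definition ext_action (E : central_extension F G) :
    gerbe_action G pt_gerbe :=
  @Action F G pt_gerbe (fun=> gf_id pt_gerbe)
    (fun g h _ => (ext_cocycle E g h)^-1) _ _ erefl _ _.
Next Obligation. by move=> E g h X Y f; apply: Gm_mulC. Qed.
Next Obligation.
move=> E g1 g2 g3 X; rewrite pt_eq_hom /=.
rewrite [RHS]mulg1 -!invgM. congr (_^-1).
by rewrite (Gm_mulC (ext_cocycle E g1 _)) ext_cocycleP Gm_mulC.
Qed.
Next Obligation.
by move=> E g X; rewrite pt_eq_hom ext_cocycle1g invg1.
Qed.
Next Obligation.
by move=> E g X; rewrite pt_eq_hom ext_cocycleg1 invg1.
Qed.

Definition ext_gerbe (E : central_extension F G) : gerbeBG F G :=
  GerbeBG (ext_action E).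

Program Definition gerbe_of_em (E E' : central_extension F G)
    (f : extension_morphism E E') :
    gerbeBG_morphism (ext_gerbe E) (ext_gerbe E') :=
  @GerbeBGMorphism F G (ext_gerbe E) (ext_gerbe E') (gf_id pt_gerbe)
    (fun g _ => em_coef f g) _ _.
Next Obligation. by move=> E E' f g X Y a; apply: Gm_mulC. Qed.
Next Obligation.
move=> E E' f g h X /=.
apply: (@mulgI _ (ext_cocycle E' g h)); rewrite mulVKg.
rewrite mulgA (Gm_mulC (ext_cocycle E' g h)).
rewrite (Gm_mulC (em_coef f h)) -em_coefM.
by rewrite (Gm_mulC (ext_cocycle E _ _)) mulgK.
Qed.

Lemma gerbe_of_em_ceq (E E' : central_extension F G)
    (f f' : extension_morphism E E') :
  isomorphic_morphisms (gerbe_of_em f) (gerbe_of_em f') <-> f =1 f'.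
Proof.
split=> [[th [_ /= e]]|e].
  by apply: em_coef_inj => g; apply: (@mulgI _ (th tt)); rewrite [LHS]e Gm_mulC.
exists (fun _ => 1 : Gm F); split=> [X Y a|g X] /=.
  exact: Gm_mulC.
by rewrite /em_coef e; apply: Gm_mulC.
Qed.

Program Definition gerbe_functor_of_extensions :
    functor (central_extensions F G) (gerbesBG F G) :=
  @Functor (central_extensions F G) (gerbesBG F G) ext_gerbe gerbe_of_em
    _ _ _.
Next Obligation. by move=> E E' f f' e; apply/gerbe_of_em_ceq. Qed.
Next Obligation.
move=> E; exists (fun _ => 1 : Gm F).
split=> [X Y a|g X] /=; first exact: Gm_mulC.
by rewrite em_coef_id.
Qed.
Next Obligation.
move=> E1 E2 E3 f' f; exists (fun _ => 1 : Gm F).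
split=> [X Y a|g X] /=; first exact: Gm_mulC.
by rewrite em_coef_comp; apply: Gm_mulC.
Qed.

(** * Fullness and essential surjectivity *)

Lemma gerbe_of_em_full (E E' : central_extension F G)
    (Phi : gerbeBG_morphism (ext_gerbe E) (ext_gerbe E')) :
  exists f, isomorphic_morphisms (gerbe_of_em f) Phi.
Proof.
pose b g : Gm F := gm_beta Phi g tt.
have bM g h : ext_cocycle E g h * b (g * h) = b g * b h * ext_cocycle E' g h.
  have := gm_tau Phi g h tt; rewrite pt_gerbe_map /= -!/(b _) => e.
  have {}e : b (g * h) = ext_cocycle E' g h * (b h * b g / ext_cocycle E g h).
    by apply: (@mulgI _ (ext_cocycle E' g h)^-1); rewrite mulKg.
  rewrite e Gm_mulC mulgA mulgVK.
  by rewrite (Gm_mulC (ext_cocycle _ _ _)) (Gm_mulC (b h)).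
(* Respecting [Gm], [Phi] is the identity on arrows, so the constant 1 is natural. *)
exists (em_of_coef bM); exists (fun _ => 1 : Gm F).
split=> [[] [] a|g []] /=; first by rewrite pt_gerbe_map; apply: Gm_mulC.
by rewrite em_coefK; apply: Gm_mulC.
Qed.

(** Any morphism suffices, since [gerbeBG_morphism_inv] inverts it. *)
Lemma ext_gerbe_surj (A : gerbeBG F G) :
  exists E, inhabited (gerbeBG_morphism (ext_gerbe E) A).
Proof.
have [X] := gb_inhabited A.
have tX g : exists t : arr X (gBG_act A g X), True.
  by have [t] := gb_connected X (gBG_act A g X); exists t.
pose t g := sval (cid (tX g)).
(* This absorbs the [eq_hom] of [act_tauA]. *)
have tE g g' (e : g = g') :
    eq_hom (eq_gf_ob (congr1 (gBG_act A) e) X) \o t g = t g'.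
  by case: g' / e; rewrite /= hcomp1f.
have kX g h : exists a, act_tau (gBG_act A) g h X \o t (g * h) \o gb_aut X a
    = gf_map (gBG_act A g) (t h) \o t g.
  have [a ea] := gb_aut_surj (hinv (act_tau (gBG_act A) g h X \o t (g * h)) \o
     (gf_map (gBG_act A g) (t h) \o t g)).
  by exists a; rewrite ea hcompVKf.
pose k g h := sval (cid (kX g h)).
have kE g h : act_tau (gBG_act A) g h X \o t (g * h) \o gb_aut X (k g h)
    = gf_map (gBG_act A g) (t h) \o t g.
  exact: svalP (cid (kX g h)).
have kE' g h Y (f : arr Y X) :
    act_tau (gBG_act A) g h X \o (t (g * h) \o (gb_aut X (k g h) \o f))
    = gf_map (gBG_act A g) (t h) \o (t g \o f).
  by rewrite !hcompA kE.
have kP : is_cocycle k.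
  move=> g1 g2 g3; apply: (@gb_aut_inj _ _ X).
  apply: (hcompI (g := gf_map (gBG_act A g1) (act_tau (gBG_act A) g2 g3 X) \o
    act_tau (gBG_act A) g1 (g2 * g3) X \o t (g1 * (g2 * g3)))).
  (* By [kE], either product in [Gm] carries the arrow just composed with to this one; the second
     case goes through [act_tauA]. *)
  transitivity (gf_map (gBG_act A g1) (gf_map (gBG_act A g2) (t g3)) \o
    (gf_map (gBG_act A g1) (t g2) \o t g1)).
    rewrite (Gm_mulC (k g2 g3)) gb_autM -!hcompA kE' gb_aut_nat -gf_aut.
    by rewrite !hcompA -!gf_mapM kE.
  symmetry; rewrite act_tauA -!hcompA (hcompA (eq_hom _)) tE.
  rewrite (Gm_mulC (k g1 g2)) gb_autM kE' hcompA -act_tau_nat -hcompA.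
  by rewrite (hcompA (act_tau _ _ _ _)) kE.
pose E := tw_extension kP; exists E.
(* The section [g |-> (1, g)] has cocycle [k], but [ext_sec E] may be another section; [s] is their
   ratio and [sM] relates the cocycles. *)
pose s g := (ext_sec E g : twisted_product kP).1.
have s2 g : (ext_sec E g : twisted_product kP).2 = g by exact: (ext_secK E g).
have sM g h : s g * s h * k g h = ext_cocycle E g h * s (g * h).
  have := congr1 fst (etrans (ext_secM E g h)
    (@tw_in_mul _ _ _ kP (ext_cocycle E g h) (ext_sec E (g * h)))).
  by rewrite /= !s2.
pose Phi : gerbe_functor pt_gerbe A :=
  @GerbeFunctor F pt_gerbe A (fun=> X) (fun _ _ a => gb_aut X a)
    (fun=> gb_aut1 X) (fun _ _ _ a b => gb_autM X a b) (fun _ _ => erefl).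
(* Rescaling [t] by [s] replaces its cocycle [k] by [ext_cocycle E]. *)
pose b g (x : pt_gerbe) : arr (Phi x) (gBG_act A g (Phi x)) :=
  t g \o gb_aut X (s g).
have b_nat g x y (a : arr x y) : gf_map (gBG_act A g) (gf_map Phi a) \o b g x
    = b g y \o gf_map Phi (gf_map (gBG_act (ext_gerbe E) g) a).
  by rewrite /b gf_aut -gb_aut_nat -!hcompA -!gb_autM Gm_mulC.
have b_tau g h x : act_tau (gBG_act A) g h (Phi x) \o b (g * h) x
    = gf_map (gBG_act A g) (b h x) \o b g (gBG_act (ext_gerbe E) h x)
      \o gf_map Phi (act_tau (gBG_act (ext_gerbe E)) g h x).
  rewrite /b /= gf_mapM gf_aut -!hcompA (hcompA (gb_aut _ _) (t g)).
  rewrite -gb_aut_nat -!hcompA -kE' -!gb_autM; do 2 congr (_ \o _).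
  congr (gb_aut X _).
  apply: (@mulgI _ (ext_cocycle E g h)); rewrite -sM.
  rewrite !mulgA (Gm_mulC _ (_^-1)) !mulgA mulVg mul1g.
  by rewrite -mulgA Gm_mulC (Gm_mulC (s h)).
by constructor; apply: (@GerbeBGMorphism F G (ext_gerbe E) A Phi b b_nat b_tau).
Qed.

End GerbeOfExtension.

Theorem theorem2 (F : fieldType) (G : groupType) :
  equivalent_categories (central_extensions F G) (gerbesBG F G).
Proof.
apply: (@fully_faithful_equivalence _ _ (gerbe_functor_of_extensions F G)).
- by move=> E E' f f' /gerbe_of_em_ceq.
- exact: gerbe_of_em_full.
move=> A; have [E [Phi]] := ext_gerbe_surj A.
have [Psi [ePhi ePsi]] := gerbeBG_morphism_inv Phi.
by exists E, Phi, Psi.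
Qed.
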